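(* Fix finite sets of local output variables $O_{\mathrm{pr}}\ni\mathsf{snd}$ and input variables $I_{\mathrm{pr}}=I_{loc}\,\dot\cup\,I_{glob}$, $\mathsf{rcv}\in I_{loc}$. Let $\alpha(i)$ be a Boolean formula over the inputs (local and global) of process $i$, let $\varphi(i)$ be an LTL formula over the inputs (local and global) and outputs of process $i$, and let $\psi(i,j)$ be an LTL formula without the next-time operator ($\mathsf{LTL}\backslash\mathsf{X}$) over the outputs of processes $i$ and $j$ only. Let $P=(Q,Q_0,\Sigma_{\mathrm{pr}},\delta,\lambda)$ be a process template (with fairness condition $A_{loc}$ equal to the local assumption $\mathsf{G}\,\alpha$) satisfying (a) for every $q\in Q$ with $\mathsf{snd}\in\lambda(q)$ there is a unique $q'\in Q$ such that, for every input $\mathsf{in}\in\Sigma_{\mathrm{pr}}$ with $\mathsf{rcv}\notin\mathsf{in}$, $(q,\mathsf{in},q')$ is the only transition of $P$ from $q$ under $\mathsf{in}$ (in sending states the process ignores its inputs). For $n\in\mathbb N$ let $P^{\mathcal R(n)}$ be the fully asynchronous token-ring system (with global inputs) of $n$ copies of $P$. Then: 1. $2$ is a cutoff for $\forall i.\ \mathsf{A}_{\forall i.\,\mathsf{G}\alpha(i)}\ \varphi(i)$, i.e. $$P^{\mathcal R(2)}\models \forall i.\,\mathsf{A}_{\forall i.\,\mathsf{G}\alpha(i)}\varphi(i)\iff \forall n\ge 2:\ P^{\mathcal R(n)}\models \forall i.\,\mathsf{A}_{\forall i.\,\mathsf{G}\alpha(i)}\varphi(i).$$ 2. $4$ is a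 cutoff for $\forall i,j.\ \mathsf{A}_{\forall i.\,\mathsf{G}\alpha(i)}\ \psi(i,j)$, i.e. $$P^{\mathcal R(4)}\models \forall i,j.\,\mathsf{A}_{\forall i.\,\mathsf{G}\alpha(i)}\psi(i,j)\iff \forall n\ge 4:\ P^{\mathcal R(n)}\models \forall i,j.\,\mathsf{A}_{\forall i.\,\mathsf{G}\alpha(i)}\psi(i,j).$$
   Context: **Process template.** Let $\Sigma_{\mathrm{pr}}=2^{I_{\mathrm{pr}}}$. A process template is a labeled transition system $P=(Q,Q_0,\Sigma_{\mathrm{pr}},\delta,\lambda)$ with states $Q$, initial states $Q_0\subseteq Q$, transition relation $\delta\subseteq Q\times\Sigma_{\mathrm{pr}}\times Q$, output function $\lambda:Q\to 2^{O_{\mathrm{pr}}}$, such that: (i) $Q$ is finite and partitioned into two non-empty sets $Q=T\,\dot\cup\,NT$; states in $T$ ''have the token''. (ii) $Q_0=\{\iota_t,\iota_n\}$ with $\iota_t\in T$, $\iota_n\in NT$. (iii) $\mathsf{snd}\notin\lambda(q)$ for every $q\in NT$. (iv) Let $\Sigma^{\mathsf{rcv}}=\{\mathsf{in}\in\Sigma_{\mathrm{pr}}:\mathsf{rcv}\in \mathsf{in}\}$, $\Sigma^{\neg\mathsf{rcv}}=\Sigma_{\mathrm{pr}}\setminus\Sigma^{\mathsf{rcv}}$, $T^{\mathsf{snd}}=\{q:\mathsf{snd}\in\lambda(q)\}$, $T^{\neg\mathsf{snd}}=T\setminus T^{\mathsf{snd}}$. Then $$\delta\subseteq (T^{\mathsf{snd}}\times\Sigma^{\neg\mathsf{rcv}}\times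 NT)\cup(NT\times\Sigma^{\mathsf{rcv}}\times T)\cup(NT\times\Sigma^{\neg\mathsf{rcv}}\times NT)\cup(T^{\neg\mathsf{snd}}\times\Sigma^{\neg\mathsf{rcv}}\times T).$$ Moreover $\delta$ is non-terminating: every $q\in NT$ has a successor under every $\mathsf{in}\in\Sigma_{\mathrm{pr}}$, and every $q\in T$ has a successor under every $\mathsf{in}\in\Sigma^{\neg\mathsf{rcv}}$. (†) Given the fairness condition $A_{loc}$ (a property of sequences over $I_{\mathrm{pr}}\cup O_{\mathrm{pr}}$): from every state with the token, under any input sequence satisfying $A_{loc}$, the process reaches a state $q'$ with $\mathsf{snd}\in\lambda(q')$. **Ring and token-ring system.** $\mathcal R(n)$ is the directed ring $(V,E)$ with $V=\{1,\dots,n\}$ and $E=\{(i,i\oplus1):i\in V\}$ (addition cyclic). System inputs are $I_{\mathrm{sys}}=(I_{loc}\times V)\,\dot\cup\,I_{glob}$, $\Sigma_{\mathrm{sys}}=2^{I_{\mathrm{sys}}}$; for $\mathsf{in}\in\Sigma_{\mathrm{sys}}$, $\mathsf{in}(v)\in\Sigma_{\mathrm{pr}}$ denotes the input to process $v$: its own local inputs in $\mathsf{in}$ together with all global inputs in $\mathsf{in}$. System outputs are $O_{\mathrm{sys}}=O_{\mathrm{pr}}\times V$; write $p_i$ for $(p,i)$. The fully asynchronous system $P^{\mathcal R(n)}=(S,S_0,\Sigma_{\mathrm{sys}},\Delta,\Lambda)$ has $S=Q^V$; $S_0$ is the set of $s\in Q_0^V$ in which exactly one process has the token; $p_i\in\Lambda(s)$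 iff $p\in\lambda(s(i))$. $\Delta$ consists of the triples $(s,\mathsf{in},s')$ for which there is a set $M\subseteq V$ of moving processes such that either - (internal) for all $v\in M$: $\mathsf{snd}\notin\lambda(s(v))$, $\mathsf{rcv}\notin\mathsf{in}(v)$ and $(s(v),\mathsf{in}(v),s'(v))\in\delta$; and $s'(u)=s(u)$ for $u\in V\setminus M$; or - (token passing) there are $v,w\in M$ with $(v,w)\in E$ such that $\mathsf{snd}\in\lambda(s(v))$ and $\mathsf{snd}\notin\lambda(s(u))$ for all $u\in M\setminus\{v\}$; $\mathsf{rcv}\in\mathsf{in}(w)$ and $\mathsf{rcv}\notin\mathsf{in}(u)$ for all $u\in M\setminus\{w\}$; $(s(u),\mathsf{in}(u),s'(u))\in\delta$ for all $u\in M$; and $s'(u)=s(u)$ for $u\in V\setminus M$. **Runs.** A run is a finite or infinite sequence $x=(s_1,\mathsf{in}_1,M_1)(s_2,\mathsf{in}_2,M_2)\dots$ with $s_1\in S_0$, $(s_k,\mathsf{in}_k,s_{k+1})\in\Delta$ for all $k<|x|$, and $M_k$ the set of processes moving in that transition. **Semantics.** The local run of process $j$ is obtained from $x$ by keeping exactly the elements with $j\in M_k$ and mapping each to $(s_k(j),\mathsf{in}_k(j))$. A run satisfies a property $\varphi(j)$ or $\alpha$-assumption $\mathsf{G}\alpha(j)$ of a single process $j$ iff the local run of $j$ satisfies it as an LTL formula (atoms evaluated by $\lambda(s_k(j))$ and $\mathsf{in}_k(j)$). A run satisfies a two-process property $\psi(i,j)$ iff the sequence $\Lambda(s_1)\Lambda(s_2)\dots$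 of all elements of the run satisfies it. On finite sequences, LTL is evaluated with usual finite-trace semantics: at positions past the end, atoms, $\mathsf{X}\theta$ and $\theta\,\mathsf{U}\,\theta'$ are false, Boolean connectives are standard, $\mathsf{X}$ at the last position is false, and $\mathsf{G}\theta=\neg(\mathsf{true}\,\mathsf{U}\,\neg\theta)$. A system satisfies $\mathsf{A}_{\forall i.\,ass(i)}\theta$ iff every run that satisfies $ass(i)$ for every $i\in V$ also satisfies $\theta$. A system satisfies $\forall i.\,\mathsf{A}_{\forall i.\,ass(i)}\varphi(i)$ (resp. $\forall i,j.\,\mathsf{A}_{\forall i.\,ass(i)}\psi(i,j)$) iff this holds for every choice of process index $i\in V$ (resp. $i,j\in V$). *)

(* Defs.v *)
From HB Require Import structures.
From mathcomp Require Import all_boot.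
From mathcomp Require Import boolp.

Set Implicit Arguments.
Unset Strict Implicit.
Unset Printing Implicit Defensive.

(** * Finite and infinite words, LTL *)

(* [w k = None] means that k is past the end; positions are numbered from 0.
   Such a function is a finite or infinite sequence when it is [word_wf]. *)
Definition word (A : Type) : Type := nat -> option A.

Definition word_wf (A : Type) (w : word A) : Prop :=
  forall k, w k = None -> w k.+1 = None.

Definition word_map (A B : Type) (f : A -> B) (w : word A) : word B :=
  fun k => omap f (w k).

Definition holds_at (A : Type) (p : pred A) (w : word A) (k : nat) : bool :=
  if w k is Some a then p a else false.

(* The subsequence of the elements satisfying p: its m-th element is the element
   of w satisfying p that is preceded by exactly m others, if there is one. *)
Definition word_filter (A : Type) (p : pred A) (w : word A) : word A := fun m =>
  match pselect (exists k,
      holds_at p w k && (count (holds_at p w) (iota 0 k) == m)) with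
  | left h => w (ex_minn h)
  | right _ => None
  end.

Inductive ltl (AP : Type) : Type :=
| LTrue
| LAtom of AP
| LNot of ltl AP
| LAnd of ltl AP & ltl AP
| LNext of ltl AP
| LUntil of ltl AP & ltl AP.

Arguments LTrue {AP}.

Definition LGlobally (AP : Type) (f : ltl AP) : ltl AP :=
  LNot (LUntil LTrue (LNot f)).

Fixpoint boolean (AP : Type) (f : ltl AP) : bool :=
  match f with
  | LTrue | LAtom _ => true
  | LNot g => boolean g
  | LAnd g h => boolean g && boolean h
  | LNext _ | LUntil _ _ => false
  end.

Fixpoint next_free (AP : Type) (f : ltl AP) : bool :=
  match f with
  | LTrue | LAtom _ => true
  | LNot g => next_free g
  | LAnd g h | LUntil g h => next_free g && next_free h
  | LNext _ => false
  end.

Fixpoint ltl_map (AP AP' : Type) (r : AP -> AP') (f : ltl AP) : ltl AP' :=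
  match f with
  | LTrue => LTrue
  | LAtom p => LAtom (r p)
  | LNot g => LNot (ltl_map r g)
  | LAnd g h => LAnd (ltl_map r g) (ltl_map r h)
  | LNext g => LNext (ltl_map r g)
  | LUntil g h => LUntil (ltl_map r g) (ltl_map r h)
  end.

Fixpoint sat_at (AP : finType) (w : word {set AP}) (f : ltl AP) (k : nat) : Prop :=
  match f with
  | LTrue => True
  | LAtom p => exists2 a, w k = Some a & p \in a
  | LNot g => ~ sat_at w g k
  | LAnd g h => sat_at w g k /\ sat_at w h k
  | LNext g => isSome (w k.+1) /\ sat_at w g k.+1
  | LUntil g h => exists l, [/\ k <= l, isSome (w l), sat_at w h l &
                    forall m, k <= m < l -> sat_at w g m]
  end.

Definition sat (AP : finType) (w : word {set AP}) (f : ltl AP) : Prop :=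
  sat_at w f 0.

(** * Process templates *)

Record process (Iloc Iglob Opr : finType) : Type := Process {
  state : finType;
  init : {set state};
  token : {set state};
  delta : {set state * {set Iloc + Iglob} * state};
  output : state -> {set Opr}
}.

Section TokenRings.
Context (Iloc Iglob Opr : finType).

Notation Ipr := (Iloc + Iglob)%type.
Notation AP := (Ipr + Opr)%type.

Definition label (P : process Iloc Iglob Opr) (e : state P * {set Ipr}) : {set AP} :=
  [set p : AP | match p with
                | inl x => x \in e.2
                | inr o => o \in output e.1
                end].

(* NT is the complement of [token P]; both are non-empty by [init_states].
   [token_is_sent] quantifies over infinite paths of P: in a token state there is
   no transition under an input containing rcv. *)
Record process_template (snd : Opr) (rcv : Iloc) (Aloc : word {set AP} -> Prop)
    (P : process Iloc Iglob Opr) : Prop := ProcessTemplate {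
  init_states : exists it iu, [/\ it \in token P, iu \in ~: token P
                                & init P = [set it; iu]];
  no_snd_without_token : forall q, q \in ~: token P -> snd \notin output q;
  delta_shape :
    let T := token P in
    let NT := ~: token P in
    let Rcv := [set a : {set Ipr} | inl rcv \in a] in
    let NRcv := ~: Rcv in
    let Tsnd := [set q : state P | snd \in output q] in
    let Tnsnd := T :\: Tsnd in
    delta P \subset
      setX (setX Tsnd NRcv) NT :|: setX (setX NT Rcv) T
        :|: setX (setX NT NRcv) NT :|: setX (setX Tnsnd NRcv) T;
  nonterminating_without_token : forall (q : state P) (a : {set Ipr}),
    q \in ~: token P -> exists q', (q, a, q') \in delta P;
  nonterminating_with_token : forall (q : state P) (a : {set Ipr}),
    q \in token P -> inl rcv \notin a -> exists q', (q, a, q') \in delta P;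
  token_is_sent : forall (q : nat -> state P) (a : nat -> {set Ipr}),
    q 0 \in token P ->
    (forall k, (q k, a k, q k.+1) \in delta P) ->
    Aloc (fun k => Some (label (q k, a k))) ->
    exists k, snd \in output (q k)
}.

Definition snd_ignores_inputs (snd : Opr) (rcv : Iloc)
    (P : process Iloc Iglob Opr) : Prop :=
  forall q : state P, snd \in output q ->
  exists! q', forall a : {set Ipr}, inl rcv \notin a ->
  forall q'', (q, a, q'') \in delta P <-> q'' = q'.

(** * Token rings *)

Definition ring_edge (n : nat) : rel 'I_n := [rel v w | w == ordS v].

Notation Isys n := ((Iloc * 'I_n) + Iglob)%type.
Notation sys_state P n := {ffun 'I_n -> state P}.

Definition local_input (n : nat) (a : {set Isys n}) (v : 'I_n) : {set Ipr} :=
  [set x : Ipr | match x with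
                 | inl l => inl (l, v) \in a
                 | inr g => inr g \in a
                 end].

Definition sys_output (P : process Iloc Iglob Opr) (n : nat) (s : sys_state P n) :
    {set Opr * 'I_n} :=
  [set p | p.1 \in output (s p.2)].

Definition sys_init (P : process Iloc Iglob Opr) (n : nat) : {set sys_state P n} :=
  [set s : sys_state P n | [forall v, s v \in init P]
                         & #|[set v | s v \in token P]| == 1].

Definition internal_step (snd : Opr) (rcv : Iloc) (P : process Iloc Iglob Opr)
    (n : nat) (s : sys_state P n) (a : {set Isys n}) (M : {set 'I_n})
    (s' : sys_state P n) : Prop :=
  (forall v, v \in M -> [/\ snd \notin output (s v),
                            inl rcv \notin local_input a v
                          & (s v, local_input a v, s' v) \in delta P]) /\
  (forall u, u \notin M -> s' u = s u).

Definition token_step (snd : Opr) (rcv : Iloc) (P : process Iloc Iglob Opr)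
    (n : nat) (s : sys_state P n) (a : {set Isys n}) (M : {set 'I_n})
    (s' : sys_state P n) : Prop :=
  exists v w, [/\ v \in M, w \in M & ring_edge v w] /\
  [/\ snd \in output (s v) /\
      (forall u, u \in M :\ v -> snd \notin output (s u)),
      inl rcv \in local_input a w /\
      (forall u, u \in M :\ w -> inl rcv \notin local_input a u),
      (forall u, u \in M -> (s u, local_input a u, s' u) \in delta P)
    & (forall u, u \notin M -> s' u = s u)].

(* (s, a, s') is a transition of the system, with M as the set of moving
   processes; a process may move along a self-loop, so M is not a function of s
   and s', and a run records it. *)
Definition sys_step (snd : Opr) (rcv : Iloc) (P : process Iloc Iglob Opr)
    (n : nat) (s : sys_state P n) (a : {set Isys n}) (M : {set 'I_n})
    (s' : sys_state P n) : Prop :=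
  internal_step snd rcv s a M s' \/ token_step snd rcv s a M s'.

Notation run_elt P n := (sys_state P n * {set Isys n} * {set 'I_n})%type.

(* Nothing constrains the input and the moving set of the last element of a
   finite run: no transition leaves it. *)
Definition is_run (snd : Opr) (rcv : Iloc) (P : process Iloc Iglob Opr)
    (n : nat) (x : word (run_elt P n)) : Prop :=
  [/\ word_wf x,
      exists s a M, x 0 = Some (s, a, M) /\ s \in sys_init P n
    & forall k s a M s' a' M',
        x k = Some (s, a, M) -> x k.+1 = Some (s', a', M') ->
        sys_step snd rcv s a M s'].

Definition local_run (P : process Iloc Iglob Opr) (n : nat)
    (x : word (run_elt P n)) (j : 'I_n) : word (state P * {set Ipr}) :=
  word_map (fun e : run_elt P n =>
              let: (s, a, _) := e in (s j, local_input a j))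
    (word_filter (fun e : run_elt P n => j \in e.2) x).

Definition sat1 (P : process Iloc Iglob Opr) (n : nat)
    (x : word (run_elt P n)) (phi : ltl AP) (j : 'I_n) : Prop :=
  sat (word_map (@label P) (local_run x j)) phi.

(* In a two-process property, the atom [inl p] stands for the output p of the
   first process and [inr p] for that of the second. *)
Definition inst2 (n : nat) (i j : 'I_n) (p : Opr + Opr) : Opr * 'I_n :=
  match p with inl o => (o, i) | inr o => (o, j) end.

Definition sat2 (P : process Iloc Iglob Opr) (n : nat)
    (x : word (run_elt P n)) (psi : ltl (Opr + Opr)) (i j : 'I_n) : Prop :=
  sat (word_map (fun e : run_elt P n => sys_output e.1.1) x)
      (ltl_map (inst2 i j) psi).

Definition Galpha (alpha : ltl Ipr) : ltl AP := LGlobally (ltl_map inl alpha).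

(* The relation written A_{forall i. ass(i)} theta. *)
Definition sys_sat (snd : Opr) (rcv : Iloc) (P : process Iloc Iglob Opr) (n : nat)
    (ass : ltl AP) (theta : word (run_elt P n) -> Prop) : Prop :=
  forall x : word (run_elt P n), is_run snd rcv x ->
  (forall v : 'I_n, sat1 x ass v) -> theta x.

Definition ring_sat1 (snd : Opr) (rcv : Iloc) (P : process Iloc Iglob Opr)
    (n : nat) (ass phi : ltl AP) : Prop :=
  forall i : 'I_n,
    sys_sat snd rcv ass (fun x : word (run_elt P n) => sat1 x phi i).

Definition ring_sat2 (snd : Opr) (rcv : Iloc) (P : process Iloc Iglob Opr)
    (n : nat) (ass : ltl AP) (psi : ltl (Opr + Opr)) : Prop :=
  forall i j : 'I_n,
    sys_sat snd rcv ass (fun x : word (run_elt P n) => sat2 x psi i j).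

End TokenRings.

(* Main.v *)
(* Contract the ring of size n onto one of size m by a map c with
   c (v + 1) equal to c v or c v + 1, and such that each process to be observed
   is alone in its fibre. A run x of the large ring is imitated in the small one
   with the token always at c (token of x). The observed processes copy their
   moves and inputs; when the token of x changes fibre, the receiver and the
   sender use the inputs of the two processes that exchange it in x, so the global
   inputs agree. Before each step an unobserved process holding the token runs on
   its own until it is about to send, under a constant input satisfying alpha
   without rcv: such an input exists as soon as the token moves, since the sender
   uses one. These extra moves neither enter the local runs of the observed
   processes nor change their outputs, and only stutter the global sequence. Two
   processes suffice to isolate one, and four to isolate two, adjacent or not. *)
Require Import Defs.
From mathcomp Require Import all_boot.
From mathcomp Require Import boolp zify.

Set Implicit Arguments.
Unset Strict Implicit.
Unset Printing Implicit Defensive.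

(** * Repetition and filtering of words *)

Section Words.
Context (A : Type).
Implicit Types (p : pred A) (w : word A).

Lemma count_holds_atS p w k :
  count (holds_at p w) (iota 0 k.+1) =
  count (holds_at p w) (iota 0 k) + holds_at p w k.
Proof. by rewrite -addn1 iotaD count_cat /= addn0. Qed.

Lemma count_holds_at_mono p w k l : k <= l ->
  count (holds_at p w) (iota 0 k) <= count (holds_at p w) (iota 0 l).
Proof. by move=> kl; rewrite -(subnKC kl) iotaD count_cat leq_addr. Qed.

Lemma word_filterP p w m e :
  word_filter p w m = Some e <->
  exists k, [/\ w k = Some e, p e & count (holds_at p w) (iota 0 k) = m].
Proof.
rewrite /word_filter; case: pselect => [h|h]; last first.
  split=> // -[k [wk pe ck]]; case: h; exists k.
  by rewrite /holds_at wk pe /= ck.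
case: ex_minnP => k /andP[hk /eqP ck] _; split=> [wk|[l [wl pe cl]]].
  by exists k; split=> //; move: hk; rewrite /holds_at wk.
suff -> : k = l by [].
have hl : holds_at p w l by rewrite /holds_at wl.
case: (ltngtP k l) => // lt.
- have := count_holds_at_mono p w lt.
  by rewrite count_holds_atS hk ck cl addn1 ltnn.
- have := count_holds_at_mono p w lt.
  by rewrite count_holds_atS hl ck cl addn1 ltnn.
Qed.

End Words.

Lemma option_ext (A : Type) (u v : option A) :
  (forall e, u = Some e <-> v = Some e) -> u = v.
Proof.
case: u v => [a|] [b|] // h; first by case: (h a) => + _; move=> /(_ erefl) <-.
  by case: (h a) => + _; move=> /(_ erefl).
by case: (h b) => _; move=> /(_ erefl).
Qed.

Lemma omap_Some (A B : Type) (f : A -> B) (u : option A) b :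
  omap f u = Some b <-> exists2 a, u = Some a & f a = b.
Proof.
case: u => [a|]; last by split=> // -[].
by split=> [[<-]|[a' [->] <-//]]; exists a.
Qed.

(* The elements of w' with k %/ d = t form the block of w t; d %| k.+1 singles
   out the last position of a block. *)
Lemma word_filter_stretch (A A' B : Type) (d : nat) (w : word A) (w' : word A')
    (p : pred A) (p' : pred A') (f : A -> B) (f' : A' -> B) :
  0 < d ->
  (forall k, holds_at p' w' k = (d %| k.+1) && holds_at p w (k %/ d)) ->
  (forall k e e', d %| k.+1 -> w (k %/ d) = Some e -> w' k = Some e' ->
     f' e' = f e) ->
  word_map f' (word_filter p' w') = word_map f (word_filter p w).
Proof.
move=> d0 hp hf.
have cnt k : count (holds_at p' w') (iota 0 k) =
             count (holds_at p w) (iota 0 (k %/ d)).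
  elim: k => [|k IH]; first by rewrite div0n.
  rewrite count_holds_atS IH hp divnS // [nat_of_bool (d %| _) + _]addnC.
  by case: (d %| k.+1); rewrite ?addn1 ?addn0 ?count_holds_atS.
apply: funext => m; apply: option_ext => b; rewrite /word_map !omap_Some.
split=> -[e /word_filterP[k [wk pe ck]] <-].
- have := hp k; rewrite {1}/holds_at wk pe => /esym/andP[dk].
  rewrite /holds_at; case ew: (w (k %/ d)) => [e'|] // pe'.
  exists e'; last by rewrite (hf k e' e).
  by apply/word_filterP; exists (k %/ d); rewrite -cnt.
- pose l := k * d + d.-1.
  have lk : l %/ d = k by rewrite /l divnMDl // divn_small ?addn0 // ltn_predL.
  have dl : d %| l.+1 by rewrite /l -addnS prednK // dvdn_addr ?dvdn_mull.
  have := hp l; rewrite dl lk {2}/holds_at wk pe.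
  rewrite {1}/holds_at; case ew: (w' l) => [e'|] // pe'.
  exists e'; last by rewrite (hf l e e') ?lk.
  by apply/word_filterP; exists l; rewrite cnt lk.
Qed.

(** Stuttering invariance: [w'] repeats every letter of [w] [d] times, so position [k] sees what
    block [k %/ d] sees. *)
Lemma sat_at_stretch (AP : Type) (A A' : finType) (r : AP -> A) (r' : AP -> A')
    (d : nat) (w : word {set A}) (w' : word {set A'}) (f : ltl AP) :
  0 < d -> next_free f ->
  (forall k, isSome (w' k) = isSome (w (k %/ d))) ->
  (forall k p, sat_at w' (LAtom (r' p)) k <-> sat_at w (LAtom (r p)) (k %/ d)) ->
  forall k, sat_at w' (ltl_map r' f) k <-> sat_at w (ltl_map r f) (k %/ d).
Proof.
move=> d0 + hs ha; elim: f => [|p|g IHg|g IHg h IHh|g _|g IHg h IHh] //=.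
- by move=> _ k; exact: ha.
- by move=> nf k; rewrite IHg.
- by case/andP=> nfg nfh k; rewrite IHg // IHh.
- case/andP=> nfg nfh k; split=> -[l [kl wl hl gm]].
  + exists (l %/ d); split; first exact: leq_div2r.
    * by rewrite -hs.
    * by rewrite -IHh.
    * move=> m /andP[km ml].
      (* A representative of block [m] not before [k]: its first position, or [k] itself if [k] lies
         in the block. *)
      have md : maxn k (m * d) %/ d = m.
        case: leqP => [le|lt]; first by rewrite mulnK.
        apply/eqP; rewrite eqn_leq km /= leq_divRL //; exact: ltnW.
      rewrite -md -IHg //; apply: gm; rewrite leq_maxl gtn_max /=.
      rewrite leq_divRL // mulSn in ml.
      have := leq_div2r d; lia.
  (* The earliest position of block [l] from [k] on, so that the positions between [k] and it lie in
     earlier blocks. *)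
  + have ld : maxn k (l * d) %/ d = l.
      case: leqP => [le|lt]; first by rewrite mulnK.
      apply/eqP; rewrite eqn_leq kl /= leq_divRL //; exact: ltnW.
    exists (maxn k (l * d)); split; first exact: leq_maxl.
    * by rewrite hs ld.
    * by rewrite IHh // ld.
    * move=> m /andP[km ml]; rewrite IHg //; apply: gm.
      by rewrite leq_div2r //= ltn_divLR //; lia.
Qed.

(** * Token pushing and simulation along a contraction *)

Section Ring.
Context (Iloc Iglob Opr : finType) (snd : Opr) (rcv : Iloc).
Context (alpha : ltl (Iloc + Iglob)) (P : process Iloc Iglob Opr).
Context (alpha_boolean : boolean alpha).
Context (P_template :
  process_template snd rcv (fun w => sat w (Galpha Opr alpha)) P).

Notation Ipr := (Iloc + Iglob)%type.
Notation Isys n := ((Iloc * 'I_n) + Iglob)%type.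
Notation sys_state n := {ffun 'I_n -> state P}.
Notation run_elt n := (sys_state n * {set Isys n} * {set 'I_n})%type.

(** * The assumption on inputs, read off the elements of a run *)

Definition input_sat (a : {set Ipr}) : Prop := sat (fun=> Some a) alpha.

(** A Boolean formula looks at the current letter only, so the constant word in [input_sat] may
    stand for any word through that letter. *)
Lemma sat_at_alpha (w : word {set Ipr + Opr}) k q a :
  w k = Some (@label _ _ _ P (q, a)) ->
  sat_at w (ltl_map inl alpha) k <-> input_sat a.
Proof.
move=> wk; rewrite /input_sat /sat.
elim: alpha alpha_boolean => //= [p _|g IH bg|g IHg h IHh /andP[bg bh]].
- split=> -[b]; first by rewrite wk => -[<-]; rewrite inE; exists a.
  by move=> [<-] pa; exists (label (q, a)); rewrite ?inE.
- by rewrite IH.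
- by rewrite IHg // IHh.
Qed.

(** The witness of [LUntil] lies before the end of the word, so a finite local run is constrained
    only at its existing elements. *)
Lemma sat_Galpha (w : word (state P * {set Ipr})) :
  sat (word_map (@label _ _ _ P) w) (Galpha Opr alpha) <->
  forall k q a, w k = Some (q, a) -> input_sat a.
Proof.
rewrite /sat /=; split=> [h k q a wk|h [k [_ + + _]]].
- apply: contrapT => na; apply: h; exists k; split=> //.
    by rewrite /word_map wk.
  by rewrite (@sat_at_alpha _ _ q a) // /word_map wk.
- rewrite {1}/word_map; case wk: (w k) => [[q a]|] // _; apply.
  by rewrite (@sat_at_alpha _ _ q a) ?/word_map ?wk //; exact: h wk.
Qed.

Lemma sat1_Galpha n (x : word (run_elt n)) v :
  sat1 x (Galpha Opr alpha) v <->
  forall k s a M, x k = Some (s, a, M) -> v \in M -> input_sat (local_input a v).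
Proof.
rewrite /sat1 sat_Galpha /local_run; split=> h.
- move=> k s a M xk vM.
  (* The number of earlier moves of [v] is the position of this move in the local run. *)
  apply: (h (count (holds_at (fun e : run_elt n => v \in e.2) x) (iota 0 k)) (s v)).
  rewrite /word_map omap_Some; exists (s, a, M) => //.
  by apply/word_filterP; exists k.
- move=> m q a; rewrite /word_map omap_Some => -[[[s b] M]].
  by case/word_filterP=> k [xk /= vM _] [_ <-]; exact: h xk vM.
Qed.

(** * Token possession in single transitions, and pushing a token to a sender *)

Lemma delta_token q a q' : (q, a, q') \in delta P ->
  (q' \in token P) =
    (inl rcv \in a) || ((q \in token P) && (snd \notin output q)).
Proof.
move/(subsetP (delta_shape P_template)); rewrite !inE /=.
by case: (q \in _); case: (q' \in _); case: (inl rcv \in a);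
   case: (snd \in output q).
Qed.

Lemma delta_rcv q a q' : (q, a, q') \in delta P -> inl rcv \in a ->
  q \notin token P.
Proof.
move/(subsetP (delta_shape P_template)); rewrite !inE /=.
by case: (q \in _); case: (q' \in _); case: (inl rcv \in a);
   case: (snd \in output q).
Qed.

Lemma snd_token q : snd \in output q -> q \in token P.
Proof.
apply: contraLR => qT; apply: (no_snd_without_token P_template).
by rewrite inE.
Qed.

(* B bounds the number of moves that any token holder needs to become a sender;
   if no admissible input lacks rcv then g is the identity and no token moves. *)
Lemma token_pusher : exists (b : {set Ipr}) (g : state P -> state P) (B : nat),
  (forall q, g q = q \/ [/\ q \in token P, snd \notin output q, input_sat b,
                            inl rcv \notin b & (q, b, g q) \in delta P]) /\
  (forall a q, input_sat a -> inl rcv \notin a -> q \in token P ->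
     snd \in output (iter B g q)).
Proof.
have [[b [sb rb]]|nb] := pselect (exists b, input_sat b /\ inl rcv \notin b);
  last first.
  exists set0, id, 0; split=> [q|a q sa ra]; first by left.
  by case: nb; exists a.
have /choice[f fP] q : exists q', q \in token P -> (q, b, q') \in delta P.
  have [qT|_] := boolP (q \in token P); last by exists q.
  by have [q' ?] := nonterminating_with_token P_template qT rb; exists q'.
(* Senders are fixed points, so iterating too often does no harm. *)
pose g q := if (q \in token P) && (snd \notin output q) then f q else q.
have gP q : q \in token P -> snd \notin output q -> (q, b, g q) \in delta P.
  by move=> qT qs; rewrite /g qT qs; apply: fP.
have gT q : q \in token P -> g q \in token P.
  move=> qT; have [qs|qs] := boolP (snd \in output q); first by rewrite /g qs andbF.
  by rewrite (delta_token (gP _ qT qs)) qT qs orbT.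
have itT q k : q \in token P -> iter k g q \in token P.
  by move=> qT; elim: k => //= k; apply: gT.
(* If no iterate sends, the orbit of [q] is an infinite path under the constant admissible input
   [b], against [token_is_sent]. *)
have /choice[N NP] q : exists k, q \in token P -> snd \in output (iter k g q).
  apply: contrapT => nk; have qT : q \in token P.
    by apply: contrapT => qT; apply: nk; exists 0.
  have ns k : snd \notin output (iter k g q).
    by apply/negP => sk; apply: nk; exists k.
  have [||k] := token_is_sent P_template (q := fun k => iter k g q)
    (a := fun=> b) qT.
  - by move=> k; apply: gP; [apply: itT|apply: ns].
  - by apply/(@sat_Galpha (fun k => Some (iter k g q, b))) => k _ _ [_ <-].
  - by rewrite (negbTE (ns k)).
exists b, g, (\max_q N q); split=> [q|a q _ _ qT].
  have [/andP[qT qs]|] := boolP ((q \in token P) && (snd \notin output q)).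
    by right; split=> //; apply: gP.
  by move=> h; left; rewrite /g (negbTE h).
rewrite -(subnK (leq_bigmax q)) iterD.
elim: (_ - _) => [|k IH]; first exact: NP.
by rewrite iterS /g IH andbF.
Qed.

(** * Imitating one step in the small ring *)

Section Contraction.
Context (n m : nat) (c : 'I_n -> 'I_m) (K : {set 'I_n}).
Context (c_step : forall v, c (ordS v) = c v \/ c (ordS v) = ordS (c v)).
Context (c_tracked : forall u v, v \in K -> c u = c v -> u = v).

(** Apart from token possession, the states of untracked processes are left free. *)
Definition simulates (s : sys_state n) (S : sys_state m) : Prop :=
  exists p, [/\ forall v, (s v \in token P) = (v == p),
                forall v, (S v \in token P) = (v == c p)
              & forall v, v \in K -> S (c v) = s v].

(** Faithful on [D] only where [c] is injective; outside the image of [D] there are no local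
    inputs. *)
Definition push_input (D : {set 'I_n}) (a : {set Isys n}) : {set Isys m} :=
  [set x : Isys m | match x with
         | inl (l, w) => [exists v in D, (c v == w) && (inl (l, v) \in a)]
         | inr g => inr g \in a
         end].

Lemma local_push_input (D : {set 'I_n}) a v : {in D &, injective c} -> v \in D ->
  local_input (push_input D a) (c v) = local_input a v.
Proof.
move=> cD vD; apply/setP=> -[l|g]; rewrite !inE //.
apply/exists_inP/idP => [[u uD /andP[/eqP cuv]]|la].
  by rewrite (cD u v).
by exists v => //; rewrite eqxx.
Qed.

Definition const_input (b : {set Ipr}) : {set Isys m} :=
  [set x : Isys m | match x with
         | inl (l, _) => inl l \in b
         | inr g => inr g \in b
         end].

Lemma local_const_input b v : local_input (const_input b) v = b.
Proof. by apply/setP=> -[l|g]; rewrite !inE. Qed.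

(** The first clause preserves the local runs of tracked processes. The second transfers the
    assumption: every mover reuses the input of some mover of the large ring. *)
Definition tracks (a : {set Isys n}) (M : {set 'I_n}) (a' : {set Isys m})
    (M' : {set 'I_m}) : Prop :=
  (forall v, v \in K ->
     (c v \in M') = (v \in M) /\ local_input a' (c v) = local_input a v) /\
  (forall v', v' \in M' -> exists2 v, v \in M & local_input a' v' = local_input a v).

Lemma tracks_push (D : {set 'I_n}) a M : K \subset D -> {in D &, injective c} ->
  tracks a M (push_input D a) (c @: (M :&: D)).
Proof.
move=> KD cD; split=> [v vK|_ /imsetP[v /setIP[vM vD] ->]]; last first.
  by exists v => //; apply: local_push_input.
have vD := subsetP KD _ vK; split; last exact: local_push_input.
apply/imsetP/idP => [[u /setIP[uM uD] cvu]|vM]; first by rewrite (cD v u).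
by exists v; rewrite // inE vM.
Qed.

Lemma tracked_inj : {in K &, injective c}.
Proof. by move=> u v _ vK; apply: c_tracked. Qed.

Lemma internal_token s a M (s' : sys_state n) v :
  internal_step snd rcv s a M s' -> (s' v \in token P) = (s v \in token P).
Proof.
case=> hM hN; have [/hM[sv rv /delta_token ->]|/hN -> //] := boolP (v \in M).
by rewrite (negbTE rv) sv andbT.
Qed.

(** Only tracked processes move. This serves internal steps and also token passing inside one fibre,
    which the small ring does not see. *)
Lemma simulate_idle (s s' : sys_state n) (S : sys_state m) (a : {set Isys n})
    (M : {set 'I_n}) :
  (forall u, u \notin M -> s' u = s u) ->
  (forall v, v \in K -> S (c v) = s v) ->
  (forall v, v \in M :&: K -> [/\ snd \notin output (s v),
     inl rcv \notin local_input a v & (s v, local_input a v, s' v) \in delta P]) ->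
  exists S' : sys_state m,
   [/\ internal_step snd rcv S (push_input K a) (c @: (M :&: K)) S',
       forall v, v \in K -> S' (c v) = s' v &
       forall w, (S' w \in token P) = (S w \in token P)].
Proof.
move=> hN hS hM.
have /choice[F FP] w : exists q, (forall v, v \in K -> c v = w -> q = s' v) /\
    (w \notin c @: K -> q = S w).
  have [/imsetP[v vK ->]|wK] := boolP (w \in c @: K).
    by exists (s' v); split=> // u uK cuv; rewrite (c_tracked vK cuv).
  by exists (S w); split=> // v vK cvw; rewrite -cvw imset_f in wK.
have FK v : v \in K -> F (c v) = s' v by move=> vK; apply: (FP (c v)).1.
have step : internal_step snd rcv S (push_input K a) (c @: (M :&: K)) (finfun F).
  split=> [_ /imsetP[v vMK ->]|w wM].
    have vK : v \in K by case/setIP: vMK.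
    by rewrite ffunE FK // hS // local_push_input //; [apply: hM|apply: tracked_inj].
  rewrite ffunE; have [/imsetP[v vK wv]|/(FP w).2//] := boolP (w \in c @: K).
  rewrite wv FK // hS // hN //; apply: contra wM => vM.
  by rewrite wv imset_f // inE vM.
exists (finfun F); split=> //; first by move=> v vK; rewrite ffunE FK.
move=> w; case: step => h1 h2.
have [/h1[sv rv /delta_token ->]|/h2 -> //] := boolP (w \in c @: (M :&: K)).
by rewrite (negbTE rv) sv andbT.
Qed.

(** Untracked states are free, so an untracked image of the sender need not be ready to send; the
    last hypothesis supplies this. A tracked sender is copied and is ready anyway. *)
Lemma simulate_step (s s' : sys_state n) (S : sys_state m) a M :
  simulates s S -> sys_step snd rcv s a M s' ->
  (forall v, v \in M -> s v \in token P -> inl rcv \notin local_input a v ->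
     c v \notin c @: K -> snd \in output (S (c v))) ->
  exists S' a' M',
    [/\ tracks a M a' M', sys_step snd rcv S a' M' S' & simulates s' S'].
Proof.
case=> p [sT ST SK] + ready.
have idle := tracks_push a M (subxx K) tracked_inj.
case=> [step|[v [w [[vM wM /eqP vw] [[sv svM] [rw rwM] hM hN]]]]].
  have [u|S' [stepS S'K S'T]] := simulate_idle (a := a) step.2 SK.
    by case/setIP=> uM _; apply: step.1.
  exists S', (push_input K a), (c @: (M :&: K)); split=> //; first by left.
  exists p; split=> // u; last by rewrite S'T.
  by rewrite (internal_token _ step).
have vp : v = p by apply/eqP; rewrite -sT; apply: snd_token.
have swT : s w \notin token P by apply: delta_rcv (hM w wM) rw.
have wv : w != v by rewrite vp -sT.
have rv : inl rcv \notin local_input a v by apply: rwM; rewrite !inE eq_sym wv.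
have s'T u : (s' u \in token P) = (u == w).
  have [->|uw] := eqVneq u w; first by rewrite (delta_token (hM w wM)) rw.
  have [uM|uM] := boolP (u \in M); last first.
    by rewrite hN // sT; apply: contraNF uM => /eqP->; rewrite -vp.
  have -> : (s' u \in token P) = (s u \in token P) && (snd \notin output (s u)).
    by rewrite (delta_token (hM u uM)) (negbTE (rwM u _)) // !inE uw.
  by rewrite sT -vp; case: eqP => // ->; rewrite sv.
(* Inside one fibre, neither sender nor receiver is tracked, since tracked processes are alone in
   theirs. *)
have [cwv|cwv] := eqVneq (c w) (c v).
  have out u : u \in K -> (u != v) && (u != w).
    move=> uK; apply/andP; split; apply: contra_neq wv => eu; rewrite eu in uK.
      exact: c_tracked.
    exact/esym/c_tracked/esym.
  have [u|S' [stepS S'K S'T]] := simulate_idle (a := a) hN SK.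
    case/setIP=> uM /out/andP[uv uw]; split; last exact: hM.
      by apply: svM; rewrite !inE uv.
    by apply: rwM; rewrite !inE uw.
  exists S', (push_input K a), (c @: (M :&: K)); split=> //; first by left.
  by exists w; split=> // u; rewrite S'T ST cwv vp.
have cvw : c w = ordS (c v).
  by rewrite vw; case: (c_step v) => // e; rewrite vw e eqxx in cwv.
(* Sender and receiver move along with the tracked processes; their fibres differ, so [c] stays
   injective. *)
pose D := K :|: [set v; w].
have KD : K \subset D by apply: subsetUl.
have vD : v \in D by rewrite !inE eqxx orbT.
have wD : w \in D by rewrite !inE eqxx !orbT.
have cD : {in D &, injective c}.
  move=> u1 u2; rewrite !inE => D1 D2 e.
  have [u2K|u2K] := boolP (u2 \in K); first exact: c_tracked.
  have [u1K|u1K] := boolP (u1 \in K); first by rewrite (c_tracked u1K (esym e)).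
  move: D1 D2 e; rewrite (negbTE u1K) (negbTE u2K) /=.
  case/orP=> /eqP-> /orP[] /eqP-> // e; first by rewrite e eqxx in cwv.
  by rewrite e eqxx in cwv.
have SvT : snd \in output (S (c v)).
  have [/imsetP[u uK cvu]|cvK] := boolP (c v \in c @: K).
    by rewrite cvu SK // -(c_tracked uK cvu).
  by apply: ready => //; apply: snd_token.
have SwT : S (c w) \notin token P by rewrite ST -vp.
have /choice[F FP] z : exists q,
    [/\ forall u, u \in K -> c u = z -> q = s' u,
        forall u, u \in M :&: D -> c u = z -> (S z, local_input a u, q) \in delta P
      & z \notin c @: (M :&: D) -> q = S z].
  have [/imsetP[u uK ->]|zK] := boolP (z \in c @: K).
    have uD := subsetP KD _ uK.
    exists (s' u); split=> [u1 u1K|u1 /setIP[u1M u1D]|].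
    - by move/(c_tracked uK)->.
    - by move/(c_tracked uK)=> eu; rewrite -eu SK ?eu //; apply: hM; rewrite -eu.
    - move=> uMD; rewrite SK // hN //; apply: contra uMD => uM.
      by rewrite imset_f // inE uM.
  have nK u : u \in K -> c u <> z by move=> uK cuz; rewrite -cuz imset_f in zK.
  have [/imsetP[u /setIP[uM uD] zu]|zMD] := boolP (z \in c @: (M :&: D)); last first.
    exists (S z); split=> // [u /nK//|u uMD cuz].
    by rewrite -cuz imset_f in zMD.
  (* An untracked sender or receiver takes any successor under the input of its counterpart;
     non-termination provides one. *)
  have [q qP] : exists q, (S z, local_input a u, q) \in delta P.
    have /orP[/eqP eu|/eqP eu] : (u == v) || (u == w).
    + by move: uD; rewrite !inE => /orP[/nK|//]; rewrite zu.
    + apply: (nonterminating_with_token P_template); last by rewrite eu.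
      by rewrite zu eu; apply: snd_token.
    + by apply: (nonterminating_without_token P_template); rewrite inE zu eu.
  exists q; split=> [u1 /nK//|u1 /setIP[u1M u1D] cu1|//].
  by rewrite (cD u1 u) // cu1.
exists (finfun F), (push_input D a), (c @: (M :&: D)).
have dF u : u \in M :&: D -> (S (c u), local_input a u, F (c u)) \in delta P.
  by move=> uMD; have [_ + _] := FP (c u); apply.
have vMD : v \in M :&: D by rewrite inE vM.
have wMD : w \in M :&: D by rewrite inE wM.
have inD u : u \in D -> u != v -> u != w -> u \in K.
  by rewrite !inE => /or3P[//|/eqP->|/eqP->]; rewrite eqxx.
split; first exact: tracks_push.
- right; exists (c v), (c w); split.
    by split; [apply: imset_f|apply: imset_f|rewrite /ring_edge /= cvw].
  split.
  + split=> // z /setD1P[+ /imsetP[u uMD zu]]; rewrite zu => cuv.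
    have [->|uw] := eqVneq u w.
      by apply: (no_snd_without_token P_template); rewrite inE.
    have uv : u != v by apply: contra_neq cuv => ->.
    have [uM uD] := setIP uMD.
    by rewrite SK ?inD //; apply: svM; rewrite !inE uv.
  + split=> [|z /setD1P[+ /imsetP[u /setIP[uM uD] zu]]].
      by rewrite local_push_input.
    rewrite zu => cuw.
    rewrite local_push_input //; apply: rwM; rewrite !inE uM andbT.
    by apply: contra_neq cuw => ->.
  + move=> _ /imsetP[u uMD ->]; rewrite ffunE local_push_input //; first exact: dF.
    by case/setIP: uMD.
  + by move=> z zMD; rewrite ffunE; have [_ _] := FP z; apply.
- exists w; split=> // [z|u uK]; last first.
    by rewrite ffunE; have [+ _ _] := FP (c u); apply.
  rewrite ffunE; have [->|zw] := eqVneq z (c w).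
    by rewrite (delta_token (dF w wMD)) rw.
  have [->|zv] := eqVneq z (c v).
    by rewrite (delta_token (dF v vMD)) (negbTE rv) SvT andbF.
  have [/imsetP[u uMD zu]|zMD] := boolP (z \in c @: (M :&: D)); last first.
    have [_ _ ->] := FP z; last by [].
    by rewrite ST -vp (negbTE zv).
  have [uM uD] := setIP uMD.
  have uK : u \in K.
    by apply: inD => //; [apply: contra_neq zv|apply: contra_neq zw] => <-.
  have [Fz _ _] := FP z; rewrite (Fz u) // s'T.
  by apply: contra_neqF zw => /eqP<-.
Qed.

(** * Building the imitating run *)

Lemma simulate_init (s : sys_state n) : s \in sys_init P n ->
  exists2 S : sys_state m, S \in sys_init P m & simulates s S.
Proof.
rewrite inE => /andP[/forallP s0 /cards1P[p sp]].
have sT v : (s v \in token P) = (v == p).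
  by move/setP/(_ v): sp; rewrite !inE.
have [it [iu [itT iuT iP]]] := init_states P_template.
have /choice[F FP] z : exists q, [/\ forall u, u \in K -> c u = z -> q = s u,
    q \in init P & (q \in token P) = (z == c p)].
  have [/imsetP[u uK ->]|zK] := boolP (z \in c @: K).
    exists (s u); split=> // [u1 _ /(c_tracked uK)->//|].
    by rewrite sT; apply/eqP/eqP => [->|/esym/(c_tracked uK)].
  (* Off the tracked images, the two initial states are placed so that the token sits at [c p]. *)
  exists (if z == c p then it else iu); split=> [u uK cuz||].
  - by rewrite -cuz imset_f in zK.
  - by rewrite iP !inE; case: ifP; rewrite eqxx ?orbT.
  - by case: ifP => // _; apply/negbTE; rewrite inE in iuT.
exists (finfun F).
  rewrite inE; apply/andP; split.
    by apply/forallP=> z; rewrite ffunE; have [] := FP z.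
  apply/cards1P; exists (c p); apply/setP=> z; rewrite !inE ffunE.
  by have [] := FP z.
exists p; split=> [//|z|v vK]; rewrite ffunE; first by have [] := FP z.
by have [+ _ _] := FP (c v); apply.
Qed.

(** With [g] from [token_pusher], only an untracked token holder can change. *)
Definition settle (g : state P -> state P) (S : sys_state m) : sys_state m :=
  [ffun w => if w \in c @: K then S w else g (S w)].

Lemma iter_settle g S r w :
  iter r (settle g) S w = if w \in c @: K then S w else iter r g (S w).
Proof.
elim: r => [|r IH] /=; first by rewrite if_same.
by rewrite ffunE IH; case: (w \in _).
Qed.

(** Each element of [x] becomes a block of [d] elements; tracked processes move only at its last
    position, so inputs are compared only there. *)
Definition stretches (d : nat) (x : word (run_elt n)) (y : word (run_elt m)) : Prop :=
  forall k, match x (k %/ d), y k with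
    | None, None => True
    | Some (s, a, M), Some (s', a', M') => forall v, v \in K ->
        [/\ s' (c v) = s v, (c v \in M') = (d %| k.+1) && (v \in M)
          & d %| k.+1 -> local_input a' (c v) = local_input a v]
    | _, _ => False
    end.

Lemma simulation (x : word (run_elt n)) :
  is_run snd rcv x -> (forall v, sat1 x (Galpha Opr alpha) v) ->
  exists d (y : word (run_elt m)),
    [/\ 0 < d, is_run snd rcv y, forall v, sat1 y (Galpha Opr alpha) v
      & stretches d x y].
Proof.
case=> xwf [s0 [a0 [M0 [x0 s0P]]]] xstep xalpha.
have [b [g [B [gP gB]]]] := token_pusher.
have gT q : (g q \in token P) = (q \in token P).
  by case: (gP q) => [->//|[qT qs _ _ /delta_token ->]]; rewrite qT qs orbT.
have settle_sim s S r : simulates s S -> simulates s (iter r (settle g) S).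
  case=> p [sT ST SK]; exists p; split=> // [z|v vK].
    rewrite iter_settle; case: ifP => // _; rewrite -ST.
    by elim: r => //= r <-; rewrite gT.
  by rewrite iter_settle imset_f // SK.
have settle_step S : internal_step snd rcv S (const_input b)
    [set w | settle g S w != S w] (settle g S).
  split=> w; rewrite inE; last by rewrite negbK => /eqP.
  rewrite local_const_input ffunE; case: ifP; first by rewrite eqxx.
  by move=> _; case: (gP (S w)) => [->|[]//]; rewrite eqxx.
pose next k (S : sys_state m) (r : sys_state m * {set Isys m} * {set 'I_m}) :=
  forall s a M, x k = Some (s, a, M) -> simulates s S ->
  tracks a M r.1.2 r.2 /\
  (forall s' a1 M1, x k.+1 = Some (s', a1, M1) ->
   sys_step snd rcv (iter B (settle g) S) r.1.2 r.2 r.1.1 /\ simulates s' r.1.1).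
have /choice[h hP] (kS : nat * sys_state m) : exists r, next kS.1 kS.2 r.
  case: kS => k S; rewrite /next /=.
  have [[s [a [M [xk sS]]]]|nx] :=
    pselect (exists s a M, x k = Some (s, a, M) /\ simulates s S); last first.
    by exists (S, set0, set0) => s a M xk sS; case: nx; exists s, a, M.
  case xk1: (x k.+1) => [[[s' a1] M1]|]; last first.
    (* The last element of a finite run has no step, but it still enters local runs, so its input
       and movers must be tracked; the target [S] is a dummy. *)
    exists (S, push_input K a, c @: (M :&: K)) => s1 a1 M1.
    rewrite xk => -[<- <- <-] _; split=> // /=.
    exact: tracks_push (subxx K) tracked_inj.
  have [|v vM vT rv vK|S' [a' [M' [trk step sS']]]] :=
    @simulate_step s s' (iter B (settle g) S) a M _ (xstep _ _ _ _ _ _ _ xk xk1).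
  - exact: settle_sim.
  (* The input of [v] is admissible and lacks [rcv], so [B] pushes do lead the token holder to a
     sending state. *)
  - have /sat1_Galpha/(_ _ _ _ _ xk vM) av := xalpha v.
    rewrite iter_settle (negbTE vK); apply: gB av rv _.
    by have [p [sT ST _]] := sS; rewrite ST -(eqP (etrans (esym (sT v)) vT)).
  - exists (S', a', M') => s1 a2 M2; rewrite xk => -[<- <- <-] _.
    by split=> // s2 a3 M3 [<- _ _].
have [S0 S0P sS0] := simulate_init s0P.
(* [St k] is the small ring's state at the start of block [k]. *)
pose St := fix F k := if k is k'.+1 then (h (k', F k')).1.1 else S0.
have Stsim k s a M : x k = Some (s, a, M) -> simulates s (St k).
  elim: k s a M => [|k IH] s a M; first by rewrite x0 => -[<- _ _].
  move=> xk1; case xk: (x k) => [[[s1 a1] M1]|]; last by rewrite xwf in xk1.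
  by have [_ /(_ _ _ _ xk1)[]] := hP (k, St k) _ _ _ xk (IH _ _ _ xk).
(* A block consists of [B] pushing steps and one real step. *)
pose d := B.+1; pose Sy k := iter (k %% d) (settle g) (St (k %/ d)).
pose hy k := h (k %/ d, St (k %/ d)).
pose y k := if x (k %/ d) is Some _ then
    if d %| k.+1 then Some (Sy k, (hy k).1.2, (hy k).2)
    else Some (Sy k, const_input b, [set w | settle g (Sy k) w != Sy k w])
  else None.
have modB k : d %| k.+1 -> k %% d = B.
  move=> dk; have := divnK dk; rewrite divnS // dk mulnDl mul1n.
  by rewrite {2}(divn_eq k d) /d; lia.
have yS k s a M : y k = Some (s, a, M) -> s = Sy k.
  by rewrite /y; case: (x _) => // _; case: ifP => _ [].
have yP k e : x (k %/ d) = Some e -> exists a M, y k = Some (Sy k, a, M).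
  by rewrite /y => ->; case: ifP => _; [exists (hy k).1.2, (hy k).2|eexists; eexists].
exists d, y; split=> //.
- split.
  + move=> k; rewrite /y; case xk: (x (k %/ d)) => [e|]; first by case: ifP.
    move=> _; suff -> : x (k.+1 %/ d) = None by [].
    by rewrite divnS //; case: (d %| _) => //; apply: xwf.
  + have [a [M y0]] := yP 0 _ (etrans (congr1 x (div0n d)) x0).
    by exists S0, a, M; rewrite y0 /Sy mod0n div0n.
  + move=> k s a M s' a' M' yk yk1; rewrite (yS _ _ _ _ yk) (yS _ _ _ _ yk1).
    move: yk yk1; rewrite {1 2}/y.
    case xk: (x (k %/ d)) => [[[s1 a1] M1]|] //.
    case xk1: (x (k.+1 %/ d)) => [[[s2 a2] M2]|] // + _.
    rewrite /Sy modnS; move: xk1; rewrite divnS //.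
    case: ifP => dk; last by move=> _ [_ <- <-]; left; apply: settle_step.
    rewrite add1n => xk1 [_ <- <-]; rewrite modB //=.
    have [_] := hP (k %/ d, St (k %/ d)) _ _ _ xk (Stsim _ _ _ _ xk).
    by case/(_ _ _ _ xk1).
- move=> w; apply/sat1_Galpha => k s a M; rewrite /y.
  case xk: (x (k %/ d)) => [[[s1 a1] M1]|] //; case: ifP => dk [_ <- <-].
    have [[_ trk] _] := hP (k %/ d, St (k %/ d)) _ _ _ xk (Stsim _ _ _ _ xk).
    move/trk=> [v vM ->]; by have /sat1_Galpha/(_ _ _ _ _ xk vM) := xalpha v.
  (* A pushing step has only processes changed by [g] as movers, and such a change certifies that
     [b] is admissible. *)
  rewrite inE local_const_input ffunE; case: ifP; first by rewrite eqxx.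
  by move=> _; case: (gP (Sy k w)) => [->|[]//]; rewrite eqxx.
- move=> k; rewrite /y; case xk: (x (k %/ d)) => [[[s a] M]|] //.
  have sS := Stsim _ _ _ _ xk.
  have sSy v : v \in K -> Sy k (c v) = s v.
    by have [p [_ _]] := settle_sim _ _ (k %% d) sS; apply.
  case: ifP => dk v vK; split=> //; try exact: sSy.
  + by have [[/(_ _ vK)[-> _] _] _] := hP (k %/ d, St (k %/ d)) _ _ _ xk sS.
  + by have [[/(_ _ vK)[_ ->] _] _] := hP (k %/ d, St (k %/ d)) _ _ _ xk sS.
  + by rewrite inE ffunE imset_f // eqxx.
Qed.

(** Pushing steps drop out of the local run, which is thus the same word in both rings; [phi] may
    therefore use next. *)
Lemma sat1_stretches d x y phi v : v \in K -> 0 < d -> stretches d x y ->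
  sat1 y phi (c v) <-> sat1 x phi v.
Proof.
move=> vK d0 xy; rewrite /sat1 /local_run.
rewrite (@word_filter_stretch _ _ _ d x y (fun e : run_elt n => v \in e.2) _
  (fun e : run_elt n => let: (s, a, _) := e in (s v, local_input a v))) //.
- move=> k; move: (xy k); rewrite /holds_at.
  case: (x _) => [[[s a] M]|]; case: (y k) => [[[s' a'] M']|] //; last by rewrite andbF.
  by case/(_ v vK).
- move=> k [[s a] M] [[s' a'] M'] dk xk yk; move: (xy k); rewrite xk yk.
  by case/(_ v vK) => -> _ ->.
Qed.

(** The global output sequence is only stuttered as far as [i] and [j] can see, whence
    [next_free]. *)
Lemma sat2_stretches d x y psi i j : i \in K -> j \in K -> next_free psi ->
  0 < d -> stretches d x y -> sat2 y psi (c i) (c j) <-> sat2 x psi i j.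
Proof.
move=> iK jK nf d0 xy; rewrite /sat2 /sat -{2}(div0n d).
apply: sat_at_stretch => // k; rewrite /word_map; move: (xy k).
  by case: (x _) => [[[s a] M]|]; case: (y k) => [[[s' a'] M']|].
move=> + p /=; rewrite /word_map.
case: (x _) => [[[s a] M]|]; case: (y k) => [[[s' a'] M']|] //= h; last first.
  by split=> -[].
have [[si _ _] [sj _ _]] := (h i iK, h j jK).
by split=> -[_ [<-] pP]; eexists=> //; move: pP; rewrite !inE;
   case: p => o /=; rewrite ?si ?sj.
Qed.

End Contraction.
End Ring.

(** * Contractions onto rings of size 2 and 4 *)

(** The number of edges from [i] forward to [v]; adding [n - i] avoids truncated subtraction. *)
Definition ring_dist n (i v : 'I_n) : nat := (v + (n - i)) %% n.

Lemma ring_dist_lt n (i v : 'I_n) : ring_dist i v < n.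
Proof. by rewrite ltn_mod (leq_ltn_trans _ (ltn_ord i)). Qed.

Lemma ring_distxx n (i : 'I_n) : ring_dist i i = 0.
Proof. by rewrite /ring_dist subnKC ?modnn // ltnW. Qed.

Lemma ring_dist_inj n (i : 'I_n) : injective (ring_dist i).
Proof.
move=> u v /eqP; rewrite /ring_dist eqn_modDr !modn_small // => /eqP.
exact: val_inj.
Qed.

Lemma ring_distS n (i v : 'I_n) :
  ring_dist i (ordS v) = (ring_dist i v).+1 %% n.
Proof. by rewrite /ring_dist /= modnDml -[in RHS]addn1 modnDml addn1 addSn. Qed.

(* A staircase from 0 at distance 0 to m at distance n - 1 closes up around
   the ring, because the successor of m in 'I_m.+1 is 0. *)
Lemma ring_contraction n m (i : 'I_n) (f : nat -> nat) :
  f 0 = 0 -> f n.-1 = m -> (forall k, k < n -> f k <= m) ->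
  (forall k, k.+1 < n -> f k.+1 = f k \/ f k.+1 = (f k).+1) ->
  exists c : 'I_n -> 'I_m.+1,
    (forall v, c (ordS v) = c v \/ c (ordS v) = ordS (c v)) /\
    (forall u v, c u = c v -> f (ring_dist i u) = f (ring_dist i v)).
Proof.
move=> f0 fn fm fS.
have f_lt v : f (ring_dist i v) < m.+1 := fm _ (ring_dist_lt i v).
exists (fun v => inord (f (ring_dist i v))); split=> [v|u v /(congr1 val)];
  last by rewrite /= !inordK.
rewrite ring_distS; have [lt|ge] := ltnP (ring_dist i v).+1 n.
  rewrite modn_small //; case: (fS _ lt) => e; first by left; rewrite e.
  right; apply: val_inj; have := fm _ lt; rewrite e => le.
  by rewrite /= !inordK // modn_small.
have e : (ring_dist i v).+1 = n by apply/eqP; rewrite eqn_leq ge ring_dist_lt.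
rewrite e modnn f0; right; apply: val_inj; rewrite /= !inordK //.
have -> : ring_dist i v = n.-1 by lia.
by rewrite fn modnn.
Qed.

Lemma ring_contraction2 n (i : 'I_n) : 2 <= n -> exists c : 'I_n -> 'I_2,
  (forall v, c (ordS v) = c v \/ c (ordS v) = ordS (c v)) /\
  (forall u v, v \in [set i] -> c u = c v -> u = v).
Proof.
(* The staircase keeps [i] at 0 and sends all other processes to 1. *)
move=> n2; have [||||c [cS cE]] := @ring_contraction n 1 i (minn^~ 1);
  try by lia.
exists c; split=> // u v /set1P-> /cE; rewrite ring_distxx => e.
by apply: (@ring_dist_inj _ i); rewrite ring_distxx; lia.
Qed.

Lemma ring_contraction4 n (i j : 'I_n) : 4 <= n -> exists c : 'I_n -> 'I_4,
  (forall v, c (ordS v) = c v \/ c (ordS v) = ordS (c v)) /\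
  (forall u v, v \in [set i; j] -> c u = c v -> u = v).
Proof.
move=> n4; set d := ring_dist i j; have dn : d < n := ring_dist_lt i j.
have [f [f0 fn fm fS fI]] : exists f, [/\ f 0 = 0, f n.-1 = 3,
    forall k, k < n -> f k <= 3,
    forall k, k.+1 < n -> f k.+1 = f k \/ f k.+1 = (f k).+1
  & forall k, k < n -> (f k = f 0 -> k = 0) /\ (f k = f d -> k = d)].
  (* Distances 0, 1 and 2 are kept apart, and the rest goes to 3. *)
  have [d2|d3] := leqP d 2; first by exists (minn^~ 3); split; lia.
  have [dm|dm] := eqVneq d n.-1.
    (* Here [j] precedes [i] on the ring: it gets 3, and the distances from 2 to [n - 2] share the
       value 2. *)
    by exists (fun k => minn k 2 + (k == d)); split; lia.
  (* Both arcs between [i] and [j] are non-empty and collapse to 1 and 3, with [j] at 2. *)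
  by exists (fun k => (0 < k) + (d <= k) + (d < k)); split; lia.
have [c [cS cE]] := ring_contraction i f0 fn fm fS.
exists c; split=> // u v ijv /cE.
have [I0 Id] := fI _ (ring_dist_lt i u).
case/set2P: ijv => ->; last by move/Id/ring_dist_inj.
by rewrite ring_distxx => /I0; rewrite -(ring_distxx i) => /ring_dist_inj.
Qed.

Theorem theorem3 (Iloc Iglob Opr : finType) (snd : Opr) (rcv : Iloc)
    (alpha : ltl (Iloc + Iglob)) (phi : ltl (Iloc + Iglob + Opr))
    (psi : ltl (Opr + Opr)) (P : process Iloc Iglob Opr)
    (alpha_boolean : boolean alpha)
    (psi_next_free : next_free psi)
    (P_template :
       process_template snd rcv (fun w => sat w (Galpha Opr alpha)) P)
    (P_snd : snd_ignores_inputs snd rcv P) :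
  (ring_sat1 snd rcv P 2 (Galpha Opr alpha) phi <->
     forall n : nat, 2 <= n -> ring_sat1 snd rcv P n (Galpha Opr alpha) phi) /\
  (ring_sat2 snd rcv P 4 (Galpha Opr alpha) psi <->
     forall n : nat, 4 <= n -> ring_sat2 snd rcv P n (Galpha Opr alpha) psi).
Proof.
(* The converse directions just instantiate [n] with the cutoff. *)
split; split=> [h n n_ge|]; try exact.
- move=> i x xrun xa; have [c [cS cI]] := ring_contraction2 i n_ge.
  have [d [y [d0 yrun ya xy]]] :=
    simulation alpha_boolean P_template cS cI xrun xa.
  by apply/(sat1_stretches _ (set11 i) d0 xy)/h.
- move=> i j x xrun xa; have [c [cS cI]] := ring_contraction4 i j n_ge.
  have [d [y [d0 yrun ya xy]]] :=
    simulation alpha_boolean P_template cS cI xrun xa.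
  by apply/(sat2_stretches (set21 i j) (set22 i j) psi_next_free d0 xy)/h.
Qed.
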